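(* Let $\Lambda$ be a row-finite $k$-graph with no sources and $R$ a commutative ring with $1$. Then $\mathcal{M}=\mathcal{D}'$, where $\mathcal{D}'=\{a\in{\rm KP}_R(\Lambda): ad=da\text{ for all }d\in\mathcal{D}\}$. In particular, $\mathcal{M}$ is a maximal commutative subalgebra of ${\rm KP}_R(\Lambda)$.
   Context: A $k$-graph is a countable category $\Lambda$ (vertices $\Lambda^0$, paths, maps $r,s$) with a degree functor $d:\Lambda\to\mathbb{N}^k$ satisfying unique factorization: if $d(\lambda)=m+n$ there are unique $\mu,\nu$ with $s(\mu)=r(\nu)$, $d(\mu)=m,d(\nu)=n$, $\lambda=\mu\nu$. $v\Lambda=\{\lambda: r(\lambda)=v\}$, $v\Lambda^n$ those of degree $n$; row-finite with no sources means each $v\Lambda^n$ is finite and nonempty. ${\rm KP}_R(\Lambda)$ is the universal $R$-algebra generated by $p_v$ ($v\in\Lambda^0$), $s_\lambda,s_{\lambda^*}$ ($d(\lambda)\ne0$) with relations (KP1) $p_v$ mutually orthogonal idempotents; (KP2) $s_\lambda s_\mu=s_{\lambda\mu}$, $s_{\mu^*}s_{\lambda^*}=s_{(\lambda\mu)^*}$, $p_{r(\lambda)}s_\lambda=s_\lambda=s_\lambda p_{s(\lambda)}$, $p_{s(\lambda)}s_{\lambda^*}=s_{\lambda^*}=s_{\lambda^*}p_{r(\lambda)}$ when $r(\mu)=s(\lambda)$; (KP3) $s_{\lambda^*}s_\mu=\delta_{\lambda,\mu}p_{s(\lambda)}$ when $d(\lambda)=d(\mu)$; (KP4) $p_v=\sum_{\lambda\in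 v\Lambda^n}s_\lambda s_{\lambda^*}$ for $n\ne0$. Convention $s_v=s_{v^*}=p_v$. $\mathcal{D}$ is the $R$-subalgebra generated by $\{s_\mu s_{\mu^*}:\mu\in\Lambda\}$. A pair $(\alpha,\beta)\in\Lambda\times\Lambda$ with $s(\alpha)=s(\beta)$ is a cycline pair if $s_{\alpha\gamma}s_{(\alpha\gamma)^*}=s_{\beta\gamma}s_{(\beta\gamma)^*}$ for all $\gamma\in s(\alpha)\Lambda$. The cycline subalgebra $\mathcal{M}$ is the $R$-subalgebra generated by $\{s_\alpha s_{\beta^*}: (\alpha,\beta)\text{ cycline}\}$. *)

(* Defs.v *)
From HB Require Import structures.
From mathcomp Require Import all_boot all_order all_algebra.
Set Implicit Arguments. Unset Strict Implicit. Unset Printing Implicit Defensive.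
Import GRing.Theory.
Local Open Scope ring_scope.

Definition deg (k : nat) := {ffun 'I_k -> nat}.
Definition deg0 (k : nat) : deg k := [ffun _ => 0%N].
Definition degD (k : nat) (m n : deg k) : deg k := [ffun i => (m i + n i)%N].

(** A k-graph: a countable category (objects V = Lambda^0, morphisms P),
    with range r, source s, identities, composition (meaningful when
    s mu = r nu), and a degree functor d satisfying unique factorization. *)
Record kgraph (k : nat) := KGraph {
  kg_V : countType;
  kg_P : countType;
  kg_r : kg_P -> kg_V;
  kg_s : kg_P -> kg_V;
  kg_id : kg_V -> kg_P;
  kg_comp : kg_P -> kg_P -> kg_P;
  kg_d : kg_P -> deg k;
  kg_id_rs : forall v, kg_r (kg_id v) = v /\ kg_s (kg_id v) = v;
  kg_comp_rs : forall mu nu, kg_s mu = kg_r nu ->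
      kg_r (kg_comp mu nu) = kg_r mu /\ kg_s (kg_comp mu nu) = kg_s nu;
  kg_id_l : forall l, kg_comp (kg_id (kg_r l)) l = l;
  kg_id_r : forall l, kg_comp l (kg_id (kg_s l)) = l;
  kg_assoc : forall l mu nu, kg_s l = kg_r mu -> kg_s mu = kg_r nu ->
      kg_comp (kg_comp l mu) nu = kg_comp l (kg_comp mu nu);
  kg_d_id : forall v, kg_d (kg_id v) = deg0 k;
  kg_d_comp : forall mu nu, kg_s mu = kg_r nu ->
      kg_d (kg_comp mu nu) = degD (kg_d mu) (kg_d nu);
  kg_fact : forall l (m n : deg k), kg_d l = degD m n ->
      exists mu nu, (kg_s mu = kg_r nu /\ kg_d mu = m /\ kg_d nu = n
                     /\ kg_comp mu nu = l) /\
        forall mu' nu', kg_s mu' = kg_r nu' -> kg_d mu' = m -> kg_d nu' = n ->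
          kg_comp mu' nu' = l -> mu' = mu /\ nu' = nu
}.


Arguments kg_r {k} k0 _ : rename.
Arguments kg_s {k} k0 _ : rename.
Arguments kg_id {k} k0 _ : rename.
Arguments kg_comp {k} k0 _ _ : rename.
Arguments kg_d {k} k0 _ : rename.

Definition row_finite_no_sources (k : nat) (L : kgraph k) : Prop :=
  forall (v : kg_V L) (n : deg k),
    (exists l : seq (kg_P L), forall lam, kg_r L lam = v -> kg_d L lam = n -> lam \in l)
    /\ (exists lam : kg_P L, kg_r L lam = v /\ kg_d L lam = n).

Definition is_nualg (R : pzRingType) (A : lmodType R) (mul : A -> A -> A) : Prop :=
  (forall x y z, mul (mul x y) z = mul x (mul y z)) /\
  (forall x y z, mul (x + y) z = mul x z + mul y z) /\
  (forall x y z, mul x (y + z) = mul x y + mul x z) /\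
  (forall (c : R) x y, mul (c *: x) y = c *: mul x y) /\
  (forall (c : R) x y, mul x (c *: y) = c *: mul x y).

Definition is_alg_hom (R : pzRingType) (A B : lmodType R)
    (mulA : A -> A -> A) (mulB : B -> B -> B) (f : A -> B) : Prop :=
  (forall x y, f (x + y) = f x + f y) /\
  (forall (c : R) x, f (c *: x) = c *: f x) /\
  (forall x y, f (mulA x y) = mulB (f x) (f y)).

(** Kumjian-Pask Lambda-family (p, s, s* ) in (A, mul); s and s* are defined
    on all paths with the convention s_v = s_{v*} = p_v (for identities). *)
Definition KP_family (k : nat) (L : kgraph k) (R : pzRingType) (A : lmodType R)
    (mul : A -> A -> A) (p : kg_V L -> A) (s ss : kg_P L -> A) : Prop :=
  (forall v, s (kg_id L v) = p v /\ ss (kg_id L v) = p v) /\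
  (forall v, mul (p v) (p v) = p v) /\
  (forall v w, v <> w -> mul (p v) (p w) = 0) /\
  (forall lam mu, kg_r L mu = kg_s L lam ->
     mul (s lam) (s mu) = s (kg_comp L lam mu) /\
     mul (ss mu) (ss lam) = ss (kg_comp L lam mu)) /\
  (forall lam, mul (p (kg_r L lam)) (s lam) = s lam /\
               mul (s lam) (p (kg_s L lam)) = s lam /\
               mul (p (kg_s L lam)) (ss lam) = ss lam /\
               mul (ss lam) (p (kg_r L lam)) = ss lam) /\
  (forall lam mu, kg_d L lam = kg_d L mu ->
     mul (ss lam) (s mu) = if lam == mu then p (kg_s L lam) else 0) /\
  (forall (v : kg_V L) (n : deg k), n <> deg0 k ->
     forall l : seq (kg_P L), uniq l ->
       (forall lam, lam \in l <-> (kg_r L lam = v /\ kg_d L lam = n)) ->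
       p v = \sum_(lam <- l) mul (s lam) (ss lam)).

Arguments KP_family {k} L {R A} mul p s ss.

Definition is_KP_algebra (k : nat) (L : kgraph k) (R : pzRingType) (A : lmodType R)
    (mul : A -> A -> A) (p : kg_V L -> A) (s ss : kg_P L -> A) : Prop :=
  is_nualg mul /\ KP_family L mul p s ss /\
  forall (B : lmodType R) (mulB : B -> B -> B) (pB : kg_V L -> B) (sB ssB : kg_P L -> B),
    is_nualg mulB -> KP_family L mulB pB sB ssB ->
    (exists f : A -> B, is_alg_hom mul mulB f /\
       (forall v, f (p v) = pB v) /\ (forall lam, f (s lam) = sB lam) /\
       (forall lam, f (ss lam) = ssB lam)) /\
    (forall f g : A -> B, is_alg_hom mul mulB f -> is_alg_hom mul mulB g ->
       (forall v, f (p v) = pB v) -> (forall lam, f (s lam) = sB lam) ->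
       (forall lam, f (ss lam) = ssB lam) ->
       (forall v, g (p v) = pB v) -> (forall lam, g (s lam) = sB lam) ->
       (forall lam, g (ss lam) = ssB lam) ->
       forall x, f x = g x).

Arguments is_KP_algebra {k} L {R A} mul p s ss.

Definition is_subalg (R : pzRingType) (A : lmodType R) (mul : A -> A -> A)
    (S : A -> Prop) : Prop :=
  S 0 /\ (forall x y, S x -> S y -> S (x + y)) /\
  (forall (c : R) x, S x -> S (c *: x)) /\
  (forall x y, S x -> S y -> S (mul x y)).

Definition gen_subalg (R : pzRingType) (A : lmodType R) (mul : A -> A -> A)
    (G : A -> Prop) : A -> Prop :=
  fun a => forall S, is_subalg mul S -> (forall g, G g -> S g) -> S a.

Definition diag_subalg (k : nat) (L : kgraph k) (R : pzRingType) (A : lmodType R)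
    (mul : A -> A -> A) (s ss : kg_P L -> A) : A -> Prop :=
  gen_subalg mul (fun a => exists mu, a = mul (s mu) (ss mu)).

Arguments diag_subalg {k} L {R A} mul s ss _.

Definition cycline_pair (k : nat) (L : kgraph k) (R : pzRingType) (A : lmodType R)
    (mul : A -> A -> A) (s ss : kg_P L -> A) (al be : kg_P L) : Prop :=
  kg_s L al = kg_s L be /\
  forall ga, kg_r L ga = kg_s L al ->
    mul (s (kg_comp L al ga)) (ss (kg_comp L al ga))
    = mul (s (kg_comp L be ga)) (ss (kg_comp L be ga)).

Arguments cycline_pair {k} L {R A} mul s ss al be.

Definition cycline_subalg (k : nat) (L : kgraph k) (R : pzRingType) (A : lmodType R)
    (mul : A -> A -> A) (s ss : kg_P L -> A) : A -> Prop :=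
  gen_subalg mul (fun a => exists al be, cycline_pair L mul s ss al be /\
                                         a = mul (s al) (ss be)).

Arguments cycline_subalg {k} L {R A} mul s ss _.

Definition commutant (R : pzRingType) (A : lmodType R) (mul : A -> A -> A)
    (D : A -> Prop) : A -> Prop :=
  fun a => forall d, D d -> mul a d = mul d a.

Definition commutative_subalg (R : pzRingType) (A : lmodType R) (mul : A -> A -> A)
    (S : A -> Prop) : Prop :=
  is_subalg mul S /\ forall x y, S x -> S y -> mul x y = mul y x.

Definition maximal_commutative_subalg (R : pzRingType) (A : lmodType R)
    (mul : A -> A -> A) (S : A -> Prop) : Prop :=
  commutative_subalg mul S /\
  forall C, commutative_subalg mul C -> (forall x, S x -> C x) -> forall x, C x -> S x.

(* Main.v *)
Require Import Defs.
From HB Require Import structures.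
From mathcomp Require Import all_boot all_order all_algebra.
From mathcomp Require Import boolp functions.

(** Let [Lambda] act on functions on [Lambda^infinity x Z^k] by prefixing and
    removing initial segments, the second coordinate recording degrees. By the
    universal property this gives a representation [f] of the algebra. Expand an
    element [x] of the commutant as a sum of terms [c(a, b) s_a s_b^*] with all
    [d b] equal, and apply [f x] to the point mass at [(b y, 0)]. Since [x]
    commutes with every [s_m s_m^*], the result is supported over [b y]; since
    its value at [(a y, d a - d b)] is [c(a, b)], a nonzero coefficient forces
    [a y = b y] for every infinite path [y], so that [(a, b)] is cycline.
    Conversely, if [(a, b)] is cycline, then [s_a s_b^*] sends [s_l], for [l] of
    large degree, to [0] or to some [s_l'] with [s_l' s_l'^* = s_l s_l^*], where
    [l'] is determined by [l] and its degree; hence such elements commute with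
    each other and with the diagonal. *)

Set Implicit Arguments. Unset Strict Implicit. Unset Printing Implicit Defensive.
Import GRing.Theory.
Local Open Scope ring_scope.

(** * Arithmetic of degrees in [N^k] *)

Section Degrees.
Variable k : nat.
Implicit Types m n : deg k.

Lemma degDC m n : degD m n = degD n m.
Proof. by apply/ffunP => i; rewrite !ffunE addnC. Qed.

Lemma degDA m n q : degD m (degD n q) = degD (degD m n) q.
Proof. by apply/ffunP => i; rewrite !ffunE addnA. Qed.

Lemma deg0D m : degD (deg0 k) m = m.
Proof. by apply/ffunP => i; rewrite !ffunE add0n. Qed.

Lemma degDI m : injective (degD m).
Proof.
by move=> n q /ffunP e; apply/ffunP => i; have := e i; rewrite !ffunE => /addnI.
Qed.

End Degrees.

(** * Unique factorization of finite paths *)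

Section Paths.
Variables (k : nat) (L : kgraph k).
Local Notation P := (kg_P L).
Local Notation r := (kg_r L).
Local Notation s := (kg_s L).
Local Notation d := (kg_d L).
Local Notation "a ** b" := (kg_comp L a b) (at level 40, left associativity).
Implicit Types (l mu nu : P) (m n : deg k).

Lemma r_comp mu nu : s mu = r nu -> r (mu ** nu) = r mu.
Proof. by case/kg_comp_rs. Qed.

Lemma s_comp mu nu : s mu = r nu -> s (mu ** nu) = s nu.
Proof. by case/kg_comp_rs. Qed.

Lemma r_id v : r (kg_id L v) = v. Proof. by case: (kg_id_rs v). Qed.
Lemma s_id v : s (kg_id L v) = v. Proof. by case: (kg_id_rs v). Qed.

Lemma deg_factor l m n : d l = degD m n ->
  exists mu nu, [/\ s mu = r nu, d mu = m, d nu = n & mu ** nu = l].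
Proof. by case/kg_fact => mu [nu [[? [? []]]]] *; exists mu, nu; split. Qed.

(** Cancelling [d mu] gives [d nu = d nu'], so both sides factor one path at the same pair of
    degrees. *)
Lemma comp_inj mu nu mu' nu' : s mu = r nu -> s mu' = r nu' -> d mu = d mu' ->
  mu ** nu = mu' ** nu' -> mu = mu' /\ nu = nu'.
Proof.
move=> h h' e E; have e2 : d nu = d nu'.
  apply: (@degDI _ (d mu)); rewrite -(kg_d_comp h) E (kg_d_comp h').
  by rewrite e.
have [a [b [_ u]]] := kg_fact (kg_d_comp h).
have [-> ->] := u _ _ h erefl erefl erefl.
by have [-> ->] := u _ _ h' (esym e) (esym e2) (esym E).
Qed.

Lemma deg0_id l : d l = deg0 k -> l = kg_id L (r l).
Proof.
move=> e; case: (@comp_inj l (kg_id L (s l)) (kg_id L (r l)) l).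
- by rewrite r_id.
- by rewrite s_id.
- by rewrite e kg_d_id.
- by rewrite kg_id_r kg_id_l.
by [].
Qed.

(** Made total by the junk value [(l, l)], so that segments and tails can be written as plain
    functions. *)
Definition factor m l : P * P :=
  if pselect (exists q : P * P, [/\ s q.1 = r q.2, d q.1 = m & q.1 ** q.2 = l])
    is left h then projT1 (cid h) else (l, l).

Lemma factorK mu nu : s mu = r nu -> factor (d mu) (mu ** nu) = (mu, nu).
Proof.
move=> h; rewrite /factor; case: pselect => [h'|[]]; last by exists (mu, nu).
case: cid => -[a b] /= [ab da abE].
by have [-> ->] := comp_inj ab h da abE.
Qed.

Lemma factorKd m mu nu : d mu = m -> s mu = r nu ->
  factor m (mu ** nu) = (mu, nu).
Proof. by move=> <-; apply: factorK. Qed.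

(** An infinite path is encoded by its initial segments: [x n] is the initial
    segment of degree [n]. *)
Definition ipath (x : deg k -> P) : Prop :=
  (forall n, d (x n) = n) /\
  (forall m n, exists2 nu, s (x m) = r nu & x (degD m n) = x m ** nu).

Definition irange (x : deg k -> P) := r (x (deg0 k)).
Definition tail m (x : deg k -> P) n : P := (factor m (x (degD m n))).2.
(** This is the infinite path [l x]: the path [l ** x n] exceeds degree [n] by [d l], and the excess
    is cut off at the source end. *)
Definition icat l (x : deg k -> P) n : P := (factor n (l ** x n)).1.

(** * Infinite paths: removing and adding initial segments *)

Section OnePath.
Variables (x : deg k -> P) (xP : ipath x).

Lemma tailE m n : s (x m) = r (tail m x n) /\ x (degD m n) = x m ** tail m x n.
Proof.
have [nu h e] := xP.2 m n.
by rewrite /tail e (factorKd (xP.1 m) h).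
Qed.

Lemma r_ipath n : r (x n) = irange x.
Proof.
by have [h e] := tailE (deg0 k) n; rewrite deg0D in e; rewrite e r_comp.
Qed.

Lemma irange_tail m : irange (tail m x) = s (x m).
Proof. by have [-> _] := tailE m (deg0 k). Qed.

Lemma ipath0 : x (deg0 k) = kg_id L (irange x).
Proof. by apply: deg0_id; rewrite xP.1. Qed.

Lemma tail0 : tail (deg0 k) x = x.
Proof.
apply/funext => n; have [h e] := tailE (deg0 k) n.
rewrite deg0D ipath0 in e; rewrite e.
by rewrite ipath0 s_id in h; rewrite h kg_id_l.
Qed.

Lemma ipath_tail m : ipath (tail m x).
Proof.
split=> [n|a b].
  have [h e] := tailE m n; apply: (@degDI _ m).
  by rewrite -(xP.1 (degD m n)) e kg_d_comp // xP.1.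
have [h e] := tailE m (degD a b); have [h1 e1] := tailE m a.
have [h2 e2] := tailE (degD m a) b.
have h3 : s (tail m x a) = r (tail (degD m a) x b).
  by rewrite -h2 e1 s_comp.
exists (tail (degD m a) x b) => //.
have := e; rewrite degDA e2 e1 kg_assoc // => E.
by have [|_ ->] := comp_inj _ h erefl E; rewrite ?r_comp.
Qed.

Lemma tail_tail m n : tail n (tail m x) = tail (degD m n) x.
Proof.
apply/funext => j; have [tP1 tP2] := ipath_tail m.
have [h e] := tailE m (degD n j); have [h1 e1] := tailE m n.
have [h2 e2] := tailE (degD m n) j.
have h3 : s (tail m x n) = r (tail (degD m n) x j) by rewrite -h2 e1 s_comp.
rewrite /tail -/(tail m x (degD n j)).
have := e; rewrite degDA e2 e1 kg_assoc // => E.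
have [|_ <-] := comp_inj _ h erefl E; first by rewrite r_comp.
by rewrite (factorKd (tP1 n)) //= -kg_assoc // -e1 (factorKd (xP.1 _)).
Qed.

Lemma icat_tail m : icat (x m) (tail m x) = x.
Proof.
apply/funext => n; have [h e] := tailE m n; have [h1 e1] := tailE n m.
by rewrite /icat -e degDC e1 (factorKd (xP.1 n)).
Qed.

Section Icat.
Variables (l : P) (lx : s l = irange x).

Let lxn n : s l = r (x n). Proof. by rewrite r_ipath. Qed.

Lemma icatE n : exists2 nu, s (icat l x n) = r nu & l ** x n = icat l x n ** nu.
Proof.
have : d (l ** x n) = degD n (d l) by rewrite kg_d_comp // xP.1 degDC.
case/deg_factor => mu [nu [h dmu dnu e]].
by exists nu; rewrite /icat -e (factorKd dmu).
Qed.

Lemma d_icat n : d (icat l x n) = n.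
Proof.
have : d (l ** x n) = degD n (d l) by rewrite kg_d_comp // xP.1 degDC.
case/deg_factor => mu [nu [h dmu dnu e]].
by rewrite /icat -e (factorKd dmu).
Qed.

(** Factor [l ** x (degD a b)] at degree [a] in two ways, once through [l ** x a] and once through
    the segment of degree [degD a b]; uniqueness identifies the two initial parts. *)
Lemma ipath_icat : ipath (icat l x).
Proof.
split=> [|a b]; first exact: d_icat.
have [mu [nu [h1 dmu dnu e1]]] := deg_factor (d_icat (degD a b)).
have [rho h2 e2] := icatE (degD a b); have [rho' h3 e3] := icatE a.
have [h4 e4] := tailE a b.
have h5 : s rho' = r (tail a x b) by rewrite -h4 -(s_comp (lxn a)) e3 s_comp.
have h6 : s nu = r rho by rewrite -h2 -e1 s_comp.
have [] := @comp_inj (icat l x a) (rho' ** tail a x b) mu (nu ** rho).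
- by rewrite r_comp.
- by rewrite r_comp.
- by rewrite d_icat dmu.
- by rewrite -!kg_assoc // -e3 e1 -e2 e4 kg_assoc.
by move=> -> _; exists nu; rewrite ?e1.
Qed.

Lemma icat_deg : icat l x (d l) = l.
Proof. by rewrite /icat factorK. Qed.
End Icat.
End OnePath.

Lemma irange_icat x l : ipath x -> s l = irange x -> irange (icat l x) = r l.
Proof.
by move=> xP lx; rewrite -(r_ipath (ipath_icat xP lx) (d l)) icat_deg.
Qed.

Lemma tail_icat x l : ipath x -> s l = irange x -> tail (d l) (icat l x) = x.
Proof.
move=> xP lx; apply/funext => n.
have lxn j : s l = r (x j) by rewrite r_ipath.
have [h e] := tailE xP n (d l).
have E : icat l x (degD (d l) n) = l ** x n.
  rewrite /icat degDC e -kg_assoc // degDC.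
  have -> : degD (d l) n = d (l ** x n) by rewrite kg_d_comp // xP.1.
  by rewrite factorK // s_comp.
by rewrite /tail E factorK.
Qed.

Lemma ipath_eq x y m : ipath x -> ipath y -> x m = y m -> tail m x = tail m y ->
  x = y.
Proof. by move=> xP yP e e'; rewrite -(icat_tail xP m) e e' icat_tail. Qed.

Lemma icat_seg x l n : ipath x -> s l = irange x ->
  icat l x (degD (d l) n) = l ** x n.
Proof.
move=> xP lx; have yP := ipath_icat xP lx.
by have [_ ->] := tailE yP (d l) n; rewrite icat_deg // tail_icat.
Qed.

(** Both sides start with [mu ** nu] and have tail [x] after it, which determines an infinite
    path. *)
Lemma icat_comp x mu nu : ipath x -> s mu = r nu -> s nu = irange x ->
  icat (mu ** nu) x = icat mu (icat nu x).
Proof.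
move=> xP h nx; have yP := ipath_icat xP nx.
have my : s mu = irange (icat nu x) by rewrite irange_icat.
apply: (@ipath_eq _ _ (d (mu ** nu))).
- by apply: ipath_icat => //; rewrite s_comp.
- exact: ipath_icat.
- by rewrite icat_deg ?s_comp // kg_d_comp // icat_seg // icat_deg.
rewrite tail_icat ?s_comp // kg_d_comp // -tail_tail; last exact: ipath_icat.
by rewrite !tail_icat.
Qed.

Lemma icat_id x : ipath x -> icat (kg_id L (irange x)) x = x.
Proof.
move=> xP; apply/funext => n; rewrite /icat -(r_ipath xP n) kg_id_l.
by rewrite -{1}(kg_id_r (x n)) (factorKd (xP.1 n)) ?r_id.
Qed.

(** * Existence of infinite paths from every vertex *)

Section Existence.
Hypothesis ns : row_finite_no_sources L.

(** Without sources, paths of degree [(1,...,1)] can be appended forever. The resulting [w j] has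
    degree [(j,...,j)] and extends every earlier one, so a segment of any degree [n] can be cut from
    a late [w j]. *)
Lemma exists_ipath v : exists2 x, ipath x & irange x = v.
Proof.
pose one : deg k := [ffun=> 1%N].
have /choice [nx nxP] : forall w, exists l, r l = w /\ d l = one.
  by move=> w; case: (ns w one).
pose w j := iter j (fun l => l ** nx (s l)) (kg_id L v).
have wS j : s (w j) = r (nx (s (w j))) by rewrite (nxP _).1.
have dw j : d (w j) = [ffun=> j].
  elim: j => [|j IH]; first by rewrite kg_d_id; apply/ffunP => i; rewrite !ffunE.
  rewrite /= kg_d_comp // IH (nxP _).2.
  by apply/ffunP => i; rewrite !ffunE addn1.
have w_pre j i : exists2 nu, s (w i) = r nu & w (i + j)%N = w i ** nu.
  elim: j => [|j [nu h IH]].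
    by exists (kg_id L (s (w i))); rewrite ?r_id // addn0 kg_id_r.
  have h' := wS (i + j)%N.
  exists (nu ** nx (s (w (i + j)%N))); rewrite ?r_comp // -1?(s_comp h) -?IH //.
  by rewrite addnS /= -/(w (i + j)%N) {1}IH kg_assoc // -(s_comp h) -IH.
(* The sum of the coordinates bounds each of them, so [w j] with [j] at least [sz n] has an initial
   segment of degree [n]. *)
pose sz (n : deg k) := (\sum_i n i)%N.
have wn n j : (sz n <= j)%N -> exists mu nu, [/\ s mu = r nu, d mu = n & mu ** nu = w j].
  move=> nj; have : d (w j) = degD n [ffun i => (j - n i)%N].
    apply/ffunP => i; rewrite dw !ffunE subnKC //.
    by apply: leq_trans nj; rewrite /sz (bigD1 i) //= leq_addr.
  by case/deg_factor => mu [nu [? ? ? ?]]; exists mu, nu.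
pose x n := (factor n (w (sz n))).1.
have xE n j : (sz n <= j)%N -> d (x n) = n /\ exists2 nu, s (x n) = r nu & w j = x n ** nu.
  move=> nj; have [mu [nu [h dm e]]] := wn n _ (leqnn _).
  have -> : x n = mu by rewrite /x -e (factorKd dm).
  split=> //; have [ka h' e'] := w_pre (j - sz n)%N (sz n).
  have h2 : s nu = r ka by rewrite -h' -e s_comp.
  rewrite subnKC // -e kg_assoc // in e'.
  by exists (nu ** ka) => //; rewrite r_comp.
have xP : ipath x.
  split=> [n|m n]; first by have [] := xE n _ (leqnn _).
  have [dx [nu h e]] := xE (degD m n) _ (leqnn _).
  have le_mn : (sz m <= sz (degD m n))%N.
    by apply: leq_sum => i _; rewrite ffunE leq_addr.
  have [dx' [nu' h' e']] := xE m _ le_mn.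
  have [a [b [ab da db abE]]] := deg_factor dx.
  have bn : s b = r nu by rewrite -h -abE s_comp.
  have [] := @comp_inj (x m) nu' a (b ** nu); rewrite ?r_comp ?dx' ?da //.
    by rewrite -e' e -abE kg_assoc.
  by move=> -> _; exists b.
exists x => //; have [_ [nu h e]] := xE (deg0 k) _ (leqnn _).
have sz0 : sz (deg0 k) = 0%N by apply: big1 => i _; rewrite ffunE.
by rewrite /irange -(r_comp h) -e sz0 /= r_id.
Qed.

End Existence.
End Paths.

(** * Submodules as modules in their own right *)

Record submodule (R : pzRingType) (V : lmodType R) := Submodule {
  submod_pred :> V -> Prop;
  submod0 : submod_pred 0;
  submodD : forall x y, submod_pred x -> submod_pred y -> submod_pred (x + y);
  submodZ : forall (c : R) x, submod_pred x -> submod_pred (c *: x) }.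

(** Membership is stored as a boolean, so that proofs of it are irrelevant and the subtype inherits
    the module structure. *)
Record submod_type (R : pzRingType) (V : lmodType R) (S : submodule V) :=
  SubmodElt { submod_val : V; submod_valP : `[< S submod_val >] }.

Section SubmodType.
Variables (R : pzRingType) (V : lmodType R) (S : submodule V).

HB.instance Definition _ := [isSub for @submod_val R V S].
HB.instance Definition _ := [Choice of submod_type S by <:].

Fact submod_pred_closed : GRing.subsemimod_closed (fun x : V => `[< S x >]).
Proof.
split; first split.
- by apply/asboolP/submod0.
- by move=> x y /asboolP Sx /asboolP Sy; apply/asboolP/submodD.
- by move=> c x /asboolP Sx; apply/asboolP/submodZ.
Qed.

HB.instance Definition _ :=
  GRing.SubChoice_isSubLmodule.Build R V (fun x : V => `[< S x >])
    (submod_type S) submod_pred_closed.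

Lemma submod_valK (x : submod_type S) : S (val x).
Proof. by case: x => x /= /asboolP. Qed.

Lemma submod_val0 : val (0 : submod_type S) = 0.
Proof. exact: (raddf0 (val : submod_type S -> V)). Qed.

Lemma submod_valD (x y : submod_type S) :
  submod_val (x + y) = submod_val x + submod_val y.
Proof. exact: (raddfD (val : submod_type S -> V)). Qed.

Lemma submod_valZ c (x : submod_type S) : submod_val (c *: x) = c *: submod_val x.
Proof. exact: (linearZ_LR (val : submod_type S -> V)). Qed.

Lemma submod_val_sum I (e : seq I) (F : I -> submod_type S) :
  submod_val (\sum_(i <- e) F i) = \sum_(i <- e) submod_val (F i).
Proof. exact: (raddf_sum (val : submod_type S -> V)). Qed.

End SubmodType.

(** * Consequences of the universal property *)

Section Universal.
Variables (k : nat) (L : kgraph k) (R : pzRingType) (A : lmodType R).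
Variables (mul : A -> A -> A) (p : kg_V L -> A) (s ss : kg_P L -> A).
Hypothesis univ : is_KP_algebra L mul p s ss.

(** Only [S] has to be an algebra under [mulB]: composition of arbitrary
    operators is not bilinear, composition of linear ones is. *)
Lemma KP_hom_sub (B : lmodType R) (S : submodule B) (mulB : B -> B -> B)
    (pB : kg_V L -> B) (sB ssB : kg_P L -> B) :
  (forall x y, S x -> S y -> S (mulB x y)) ->
  (forall x y z, S x -> S y -> S z ->
    [/\ mulB (mulB x y) z = mulB x (mulB y z),
        mulB (x + y) z = mulB x z + mulB y z &
        mulB x (y + z) = mulB x y + mulB x z]) ->
  (forall (c : R) x y, S x -> S y ->
    mulB (c *: x) y = c *: mulB x y /\ mulB x (c *: y) = c *: mulB x y) ->
  (forall v, S (pB v)) -> (forall l, S (sB l)) -> (forall l, S (ssB l)) ->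
  KP_family L mulB pB sB ssB ->
  exists f : A -> B,
    [/\ is_alg_hom mul mulB f, forall a, S (f a), forall v, f (p v) = pB v,
        forall l, f (s l) = sB l & forall l, f (ss l) = ssB l].
Proof.
move=> SM alg algZ Sp Ss Sss fam; have [_ [_ ex]] := univ.
(* The universal property ranges over module types, so it is applied to [S] as a subtype with [mulB]
   restricted to it. *)
pose mk x (Sx : S x) : submod_type S := SubmodElt (asboolT Sx).
pose mulS (x y : submod_type S) := mk _ (SM _ _ (submod_valK x) (submod_valK y)).
have [||[f [[fD [fZ fM]] [fp [fs fss]]]] _] :=
  ex _ mulS (fun v => mk _ (Sp v)) (fun l => mk _ (Ss l)) (fun l => mk _ (Sss l)).
- split; [|split; [|split; [|split]]].
  + move=> x y z; apply: val_inj => /=.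
    by have [] := alg _ _ _ (submod_valK x) (submod_valK y) (submod_valK z).
  + move=> x y z; apply: val_inj; rewrite /= ?submod_valD.
    by have [] := alg _ _ _ (submod_valK x) (submod_valK y) (submod_valK z).
  + move=> x y z; apply: val_inj; rewrite /= ?submod_valD.
    by have [] := alg _ _ _ (submod_valK x) (submod_valK y) (submod_valK z).
  + move=> c x y; apply: val_inj; rewrite /= ?submod_valZ.
    by have [] := algZ c _ _ (submod_valK x) (submod_valK y).
  + move=> c x y; apply: val_inj; rewrite /= ?submod_valZ.
    by have [] := algZ c _ _ (submod_valK x) (submod_valK y).
- have [f1 [f2 [f3 [f4 [f5 [f6 f7]]]]]] := fam.
  split; [|split; [|split; [|split; [|split; [|split]]]]].
  + by move=> v; have [? ?] := f1 v; split; apply: val_inj.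
  + by move=> v; apply: val_inj => /=.
  + by move=> v w /f3 e; apply: val_inj; exact: etrans e (esym (submod_val0 S)).
  + by move=> l m /f4 [? ?]; split; apply: val_inj.
  + by move=> l; have [? [? [? ?]]] := f5 l; do !split; apply: val_inj.
  + move=> l m /f6 e; apply: val_inj; apply: (etrans e).
    by case: (l == m) => //; exact: esym (submod_val0 S).
  + move=> v n n0 e eu eP; apply: val_inj; rewrite /= submod_val_sum.
    exact: f7 n0 e eu eP.
exists (fun a => submod_val (f a)); split; first split.
- by move=> x y; rewrite fD submod_valD.
- by split=> [c x|x y]; rewrite ?fZ ?submod_valZ ?fM.
- by move=> a; apply: submod_valK.
- by move=> v; rewrite fp.
- by move=> l; rewrite fs.
- by move=> l; rewrite fss.
Qed.

(** The universal map into [T], followed by the inclusion, fixes the generators; by uniqueness it is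
    the identity, so every element lies in [T]. *)
Lemma KP_gen (T : A -> Prop) : is_subalg mul T ->
  (forall v, T (p v)) -> (forall l, T (s l)) -> (forall l, T (ss l)) ->
  forall a, T a.
Proof.
move=> [T0 [TD [TZ TM]]] Tp Ts Tss a.
have [[mA [mDl [mDr [mZl mZr]]]] [fam uni]] := univ.
have [f [fh Tf fp fs fss]] :=
  @KP_hom_sub A (Submodule T0 TD TZ) mul p s ss TM
    (fun x y z _ _ _ => And3 (mA x y z) (mDl x y z) (mDr x y z))
    (fun c x y _ _ => conj (mZl c x y) (mZr c x y)) Tp Ts Tss fam.
have nu : is_nualg mul by [].
have [_ /(_ f id) eq_id] := uni A mul p s ss nu fam.
have idh : is_alg_hom mul mul id by do !split.
have <- : f a = a by exact: eq_id.
exact: Tf.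
Qed.

End Universal.

(** * The representation on functions of infinite paths and degrees *)

Section PathRepresentation.
Variables (k : nat) (L : kgraph k) (R : comPzRingType).
Local Notation P := (kg_P L).
Local Notation r := (kg_r L).
Local Notation s := (kg_s L).
Local Notation d := (kg_d L).
Local Notation "a ** b" := (kg_comp L a b) (at level 40, left associativity).

Local Notation W := ((deg k -> P) * {ffun 'I_k -> int})%type.
Local Notation M := (W -> R^o).

Definition degZ (m : deg k) : {ffun 'I_k -> int} := [ffun i => (m i)%:Z].

Lemma degZ0 : degZ (deg0 k) = 0.
Proof. by apply/ffunP => i; rewrite !ffunE. Qed.

Lemma degZD m n : degZ (degD m n) = degZ m + degZ n.
Proof. by apply/ffunP => i; rewrite !ffunE PoszD. Qed.

Lemma degZ_inj : injective degZ.
Proof.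
by move=> m n /ffunP e; apply/ffunP => i; have := e i; rewrite !ffunE => -[].
Qed.

(** Composition with the partial map [phi] of domain [c], extended by zero. *)
Definition pullback (c : W -> Prop) (phi : W -> W) (F : M) : M :=
  fun w => if `[< c w >] then F (phi w) else 0.

Lemma pullback_lin c phi (a : R) F G :
  pullback c phi (a *: F + G) = a *: pullback c phi F + pullback c phi G.
Proof.
apply/funext => w; rewrite /pullback !fctE.
by case: asboolP => // _; rewrite scaler0 addr0.
Qed.

Lemma pullback_comp c phi c' phi' F :
  pullback c phi (pullback c' phi' F) =
  pullback (fun w => c w /\ c' (phi w)) (phi' \o phi) F.
Proof.
apply/funext => w; rewrite /pullback /=.
case: asboolP => [cw|ncw]; last by case: asboolP => // -[].
by case: asboolP => [c'w|nc'w]; case: asboolP => // -[].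
Qed.

Lemma eq_pullback c phi c' phi' : (forall w, c w <-> c' w) ->
  (forall w, c w -> phi w = phi' w) -> pullback c phi = pullback c' phi'.
Proof.
move=> ec ephi; apply/funext => F; apply/funext => w; rewrite /pullback.
have [cw|ncw] := asboolP (c w).
  by rewrite (asboolT ((ec w).1 cw)) ephi.
by rewrite asboolF // => /ec.
Qed.

Lemma pullback0 c phi : (forall w, ~ c w) -> pullback c phi = 0.
Proof.
by move=> nc; apply/funext => F; apply/funext => w; rewrite /pullback asboolF.
Qed.

Definition op_p v : M -> M :=
  pullback (fun w => ipath w.1 /\ irange w.1 = v) id.
(** The second coordinate separates the coefficients of paths of different
    degrees. *)
Definition op_s l : M -> M :=
  pullback (fun w => ipath w.1 /\ w.1 (d l) = l)
           (fun w => (tail (d l) w.1, w.2 - degZ (d l))).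
Definition op_ss l : M -> M :=
  pullback (fun w => ipath w.1 /\ s l = irange w.1)
           (fun w => (icat l w.1, w.2 + degZ (d l))).

Lemma path_family :
  KP_family L (fun (T U : M -> M) => T \o U) op_p op_s op_ss.
Proof.
(* All generators act by pullback, so a product relation reduces to comparing domains and values of
   partial maps. *)
have pcomp c phi c' phi' c'' phi'' :
    (forall w, c w /\ c' (phi w) <-> c'' w) ->
    (forall w, c w -> c' (phi w) -> phi' (phi w) = phi'' w) ->
    pullback c phi \o pullback c' phi' = pullback c'' phi'' :> (M -> M).
  move=> ec ephi; apply/funext => F /=; rewrite pullback_comp.
  by congr (_ F); apply: eq_pullback => // w [? ?]; apply: ephi.
split; [|split; [|split; [|split; [|split; [|split]]]]].
- move=> v; split; apply: eq_pullback => -[x n] /=; rewrite ?kg_d_id ?s_id.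
  + split=> -[xP e]; split=> //; last by rewrite ipath0 // e.
    by rewrite -(r_ipath xP (deg0 k)) e r_id.
  + by case=> xP e; rewrite degZ0 subr0 tail0.
  + by split=> -[].
  + by case=> xP ->; rewrite icat_id // degZ0 addr0.
- by move=> v; apply: pcomp => -[x n] //=; tauto.
- move=> v w vw; apply/funext => F /=; rewrite /op_p pullback_comp.
  rewrite pullback0 // => -[x n] /= [[_ e] [_ e']].
  by apply: vw; rewrite -e -e'.
- move=> l m ml; split; apply: pcomp => -[x n] /=; rewrite ?kg_d_comp ?s_comp //.
  + split=> [[[xP xl] [tP tm]]|[xP xlm]].
      by split=> //; have [_ ->] := tailE xP (d l) (d m); rewrite xl tm.
    have [h e] := tailE xP (d l) (d m); rewrite xlm in e.
    have [] := comp_inj (esym ml) h _ e; first by rewrite xP.1.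
    by move=> <- <-; split=> //; split=> //; apply: ipath_tail.
  + by move=> [xP _] _; rewrite tail_tail // degZD opprD addrA.
  + split=> [[[xP mx] [_ _]]|[xP mx]] //; split=> //.
    by split; [apply: ipath_icat | rewrite irange_icat].
  + by move=> [xP mx] _; rewrite icat_comp // degZD -addrA (addrC (degZ (d l))).
- move=> l; split; [|split; [|split]]; apply: pcomp => -[x n] //=.
  + split=> [[_ ?]|[xP xl]] //; split=> //; split=> //.
    by rewrite -(r_ipath xP (d l)) xl.
  + split=> [[? _]|[xP xl]] //; split=> //; split; first exact: ipath_tail.
    by rewrite irange_tail // xl.
  + by split=> [[_ ?]|[? ?]].
  + split=> [[? _]|[xP xl]] //; split=> //.
    by split; [apply: ipath_icat | rewrite irange_icat].
(* (KP3): the segment of [icat l x] of degree [d m = d l] is [l], so stripping [m] from it is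
   possible only if [l = m]. *)
- move=> l m dlm; case: eqP => [<-|lm].
    apply: pcomp => -[x n] /=.
      split=> [[[? ?] _]|[xP xl]] //; split=> //.
      by split; [apply: ipath_icat | rewrite icat_deg].
    by move=> [xP lx] _; rewrite tail_icat // addrK.
  apply/funext => F /=; rewrite /op_ss pullback_comp pullback0 //.
  by move=> -[x n] /= [[xP lx] [_]]; rewrite -dlm icat_deg.
(* (KP4): at [(x, z)] the only summand that can be nonzero is the one for [l = x n]. *)
- move=> v n _ e eu eP; apply/funext => F; apply/funext => -[x z].
  rewrite !fct_sumE /op_p /pullback /=.
  case: asboolP => [[xP rx]|nx]; last first.
    rewrite big_seq big1 // => l /eP [rl dl]; rewrite /op_s /pullback /=.
    case: asboolP => // -[xP xl]; case: nx; split=> //.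
    by rewrite -(r_ipath xP (d l)) xl.
  have xe : x n \in e by apply/eP; rewrite r_ipath ?xP.1.
  rewrite (bigD1_seq (x n)) //= big_seq_cond big1 ?addr0.
    rewrite /op_s /op_ss /pullback /= xP.1 asboolT // asboolT ?icat_tail ?subrK //.
    by split; [apply: ipath_tail | rewrite irange_tail].
  move=> l /andP [/eP [_ dl] /eqP lx]; rewrite /op_s /pullback /=.
  by rewrite asboolF // dl => -[_ /esym].
Qed.
End PathRepresentation.

(** * Generated subalgebras and centralizers *)

Section Subalgebras.
Variables (R : pzRingType) (A : lmodType R) (mul : A -> A -> A).
Hypothesis nu : is_nualg mul.

Lemma gen_subalgP (G : A -> Prop) : is_subalg mul (gen_subalg mul G).
Proof.
split; [|split; [|split]].
- by move=> S [].
- by move=> x y Sx Sy S SP GS; apply: SP.2.1; [apply: Sx | apply: Sy].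
- by move=> c x Sx S SP GS; apply: SP.2.2.1; apply: Sx.
- by move=> x y Sx Sy S SP GS; apply: SP.2.2.2; [apply: Sx | apply: Sy].
Qed.

Lemma nualg_mul0 x : mul x 0 = 0.
Proof.
have [_ [_ [mDr _]]] := nu; apply: (addrI (mul x 0)).
by rewrite addr0 -mDr addr0.
Qed.

Lemma nualg_0mul x : mul 0 x = 0.
Proof.
have [_ [mDl _]] := nu; apply: (addrI (mul 0 x)).
by rewrite addr0 -mDl addr0.
Qed.

Lemma nualg_sumr I (e : seq I) (F : I -> A) x :
  mul x (\sum_(i <- e) F i) = \sum_(i <- e) mul x (F i).
Proof.
have [_ [_ [mDr _]]] := nu.
by apply: (big_morph (mul x)) => [y z|]; [apply: mDr | apply: nualg_mul0].
Qed.

Lemma nualg_suml I (e : seq I) (F : I -> A) x :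
  mul (\sum_(i <- e) F i) x = \sum_(i <- e) mul (F i) x.
Proof.
have [_ [mDl _]] := nu.
by apply: (big_morph (mul^~ x)) => [y z|]; [apply: mDl | apply: nualg_0mul].
Qed.

Lemma centralizer_subalg a : is_subalg mul (fun b => mul a b = mul b a).
Proof.
have [mA [mDl [mDr [mZl mZr]]]] := nu; split; [|split; [|split]].
- by rewrite nualg_mul0 nualg_0mul.
- by move=> x y ex ey; rewrite mDl mDr ex ey.
- by move=> c x ex; rewrite mZl mZr ex.
- by move=> x y ex ey; rewrite -mA ex mA ey mA.
Qed.

(** Centralizers are subalgebras, so commutation passes from generators to generated elements, first
    on one side and then on the other. *)
Lemma gen_subalg_comm (G H : A -> Prop) :
  (forall g h, G g -> H h -> mul g h = mul h g) ->
  forall a b, gen_subalg mul G a -> gen_subalg mul H b -> mul a b = mul b a.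
Proof.
move=> GH a b Ga Hb; apply: (Hb _ (centralizer_subalg a)) => h Hh.
by apply/esym; apply: (Ga _ (centralizer_subalg h)) => g Gg; apply/esym/GH.
Qed.

End Subalgebras.

(** * Relations and expansions in the Kumjian-Pask algebra *)

Section KumjianPask.
Variables (k : nat) (L : kgraph k) (R : comPzRingType) (A : lmodType R).
Variables (mul : A -> A -> A) (p : kg_V L -> A) (s ss : kg_P L -> A).
Hypothesis rf : row_finite_no_sources L.
Hypothesis univ : is_KP_algebra L mul p s ss.

Local Notation P := (kg_P L).
Local Notation rg := (kg_r L).
Local Notation sc := (kg_s L).
Local Notation d := (kg_d L).
Local Notation "a ** b" := (kg_comp L a b) (at level 40, left associativity).
Local Notation "x · y" := (mul x y) (at level 40, left associativity).

Let nu : is_nualg mul. Proof. by case: univ. Qed.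
Let fam : KP_family L mul p s ss. Proof. by case: univ => _ []. Qed.

Let mulA x y z : x · y · z = x · (y · z). Proof. by case: nu. Qed.
Let mul0 x : x · 0 = 0. Proof. exact: nualg_mul0. Qed.
Let mul0l x : 0 · x = 0. Proof. exact: nualg_0mul. Qed.
Let s_idE v : s (kg_id L v) = p v. Proof. by case: (fam.1 v). Qed.
Let ss_idE v : ss (kg_id L v) = p v. Proof. by case: (fam.1 v). Qed.
Let ppE v : p v · p v = p v. Proof. by case: fam => _ []. Qed.
Let pp0 v w : v <> w -> p v · p w = 0.
Proof. by case: fam => _ [_ [h _]]; apply: h. Qed.
Let sM a b : sc a = rg b -> s a · s b = s (a ** b).
Proof. by case: fam => _ [_ [_ [h _]]] /esym /h []. Qed.
Let ssM a b : sc a = rg b -> ss b · ss a = ss (a ** b).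
Proof. by case: fam => _ [_ [_ [h _]]] /esym /h []. Qed.
Let ps l : p (rg l) · s l = s l.
Proof. by case: fam => _ [_ [_ [_ [h _]]]]; case: (h l). Qed.
Let sp l : s l · p (sc l) = s l.
Proof. by case: fam => _ [_ [_ [_ [h _]]]]; case: (h l) => _ []. Qed.
Let pss l : p (sc l) · ss l = ss l.
Proof. by case: fam => _ [_ [_ [_ [h _]]]]; case: (h l) => _ [_ []]. Qed.
Let ssp l : ss l · p (rg l) = ss l.
Proof. by case: fam => _ [_ [_ [_ [h _]]]]; case: (h l) => _ [_ []]. Qed.
Let ss_s l m : d l = d m -> ss l · s m = if l == m then p (sc l) else 0.
Proof. by case: fam => _ [_ [_ [_ [_ [h _]]]]]; apply: h. Qed.

Lemma exists_enum (v : kg_V L) (n : deg k) :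
  exists e : seq P, uniq e /\ forall l, l \in e <-> rg l = v /\ d l = n.
Proof.
have [[e eP] _] := rf v n.
exists (undup [seq l <- e | (rg l == v) && (d l == n)]).
split=> [|l]; first exact: undup_uniq.
rewrite mem_undup mem_filter; split=> [/andP [/andP [/eqP ? /eqP ?]]|[? ?]] //.
by rewrite eP // andbT; apply/andP; split; apply/eqP.
Qed.

Definition paths_of (v : kg_V L) (n : deg k) : seq P :=
  projT1 (cid (exists_enum v n)).

Lemma paths_of_uniq v n : uniq (paths_of v n).
Proof. by rewrite /paths_of; case: cid => e []. Qed.

Lemma paths_ofP v n l : l \in paths_of v n <-> rg l = v /\ d l = n.
Proof. by rewrite /paths_of; case: cid => e []. Qed.

(** (KP4) extended to degree 0, where the identity at [v] is the only path and contributes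
    [p v · p v = p v]. *)
Lemma p_expand v n : p v = \sum_(l <- paths_of v n) s l · ss l.
Proof.
have [-> |n0] := pselect (n = deg0 k); last first.
  case: fam => _ [_ [_ [_ [_ [_ h]]]]].
  by apply: h n0 _ (paths_of_uniq v n) _ => l; apply: paths_ofP.
have pe : perm_eq (paths_of v (deg0 k)) [:: kg_id L v].
  apply: uniq_perm => //; first exact: paths_of_uniq.
  move=> l; rewrite inE; apply/idP/eqP => [/paths_ofP [<- /deg0_id]|->] //.
  by apply/paths_ofP; rewrite r_id kg_d_id.
by rewrite (perm_big _ pe) /= big_seq1 s_idE ss_idE ppE.
Qed.

Lemma s_ss_expand a b n : sc a = sc b ->
  s a · ss b = \sum_(g <- paths_of (sc a) n) s (a ** g) · ss (b ** g).
Proof.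
move=> ab; rewrite -{1}(sp a) (p_expand _ n) nualg_sumr // nualg_suml //.
rewrite !big_seq; apply: eq_bigr => g /paths_ofP [rgg _].
by rewrite -mulA mulA sM // ssM // -ab.
Qed.

(** * Spanning by the products [s a · ss b] *)

Definition lin_span (Q : P -> P -> Prop) (a : A) : Prop :=
  exists l : seq (R * (P * P)), (forall t, t \in l -> Q t.2.1 t.2.2) /\
    a = \sum_(t <- l) t.1 *: (s t.2.1 · ss t.2.2).

Section LinSpan.
Variable Q : P -> P -> Prop.

Lemma lin_span_gen a b : Q a b -> lin_span Q (s a · ss b).
Proof.
move=> Qab; exists [:: (1, (a, b))]; split; last by rewrite big_seq1 scale1r.
by move=> t; rewrite inE => /eqP ->.
Qed.

Lemma lin_span0 : lin_span Q 0.
Proof. by exists [::]; split=> //; rewrite big_nil. Qed.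

Lemma lin_spanD x y : lin_span Q x -> lin_span Q y -> lin_span Q (x + y).
Proof.
move=> [l [lP ->]] [l' [lP' ->]]; exists (l ++ l'); split; last by rewrite big_cat.
by move=> t; rewrite mem_cat => /orP [/lP|/lP'].
Qed.

Lemma lin_spanZ c x : lin_span Q x -> lin_span Q (c *: x).
Proof.
move=> [l [lP ->]]; exists [seq (c * t.1, t.2) | t <- l]; split.
  by move=> _ /mapP [t /lP ? ->].
by rewrite big_map scaler_sumr; apply: eq_bigr => t _; rewrite scalerA.
Qed.

Lemma lin_span_sum (I : eqType) (e : seq I) (F : I -> A) :
  (forall i, i \in e -> lin_span Q (F i)) -> lin_span Q (\sum_(i <- e) F i).
Proof.
move=> h; rewrite big_seq; apply: big_ind => //; first exact: lin_span0.
exact: lin_spanD.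
Qed.
End LinSpan.

(** Both factors are expanded to the common degree [d b + d m], where (KP3)
    applies. *)
Lemma ss_s_mul b m : ss b · s m =
  \sum_(g <- paths_of (sc b) (d m)) \sum_(h <- paths_of (sc m) (d b))
    if b ** g == m ** h then s g · ss h else 0.
Proof.
rewrite -(pss b) (p_expand _ (d m)) nualg_suml // nualg_suml //.
rewrite !big_seq; apply: eq_bigr => g /paths_ofP [rgg dg].
rewrite -{1}(sp m) (p_expand _ (d b)) nualg_sumr // nualg_sumr //.
rewrite !big_seq; apply: eq_bigr => h /paths_ofP [rh dh].
have dE : d (b ** g) = d (m ** h) by rewrite !kg_d_comp // dg dh degDC.
have -> : s g · ss g · ss b · (s m · (s h · ss h)) =
          s g · ((ss (b ** g) · s (m ** h)) · ss h).
  by rewrite -(ssM (esym rgg)) -(sM (esym rh)) !mulA.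
rewrite ss_s //; case: eqP => [e|_]; last by rewrite mul0l mul0.
by rewrite s_comp // -mulA sp.
Qed.

Lemma lin_spanM x y : lin_span (fun a b => sc a = sc b) x ->
  lin_span (fun a b => sc a = sc b) y -> lin_span (fun a b => sc a = sc b) (x · y).
Proof.
have [_ [_ [_ [mZl mZr]]]] := nu.
move=> [l [lP ->]] [l' [lP' ->]]; rewrite nualg_suml //.
apply: lin_span_sum => -[c [a b]] /lP /= ab; rewrite nualg_sumr //.
apply: lin_span_sum => -[c' [m n]] /lP' /= mn; rewrite mZl mZr.
do 2!apply: lin_spanZ.
rewrite mulA -(mulA (ss b)) ss_s_mul nualg_suml // nualg_sumr //.
apply: lin_span_sum => g /paths_ofP [rgg dg]; rewrite nualg_suml // nualg_sumr //.
apply: lin_span_sum => h /paths_ofP [rh dh].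
case: eqP => [e|_]; last by rewrite mul0l mul0; apply: lin_span0.
rewrite mulA -mulA sM ?ab // ssM -?mn //; apply: lin_span_gen.
by rewrite !s_comp ?ab -?mn // -(s_comp (esym rgg)) e s_comp.
Qed.

Lemma lin_spanT x : lin_span (fun a b => sc a = sc b) x.
Proof.
apply: (KP_gen univ) x.
- split; first exact: lin_span0.
  split; first exact: lin_spanD.
  by split; [move=> c x; apply: lin_spanZ | apply: lin_spanM].
- by move=> v; rewrite -ppE -{1}s_idE -ss_idE; apply: lin_span_gen.
- by move=> l; rewrite -sp -ss_idE; apply: lin_span_gen; rewrite s_id.
- by move=> l; rewrite -pss -s_idE; apply: lin_span_gen; rewrite s_id.
Qed.

(** By (KP4), the degree of [b] in a term can be raised by any amount; raise all of them to the same
    [N]. *)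
Lemma lin_span_degree x : exists N : deg k,
  lin_span (fun a b => sc a = sc b /\ d b = N) x.
Proof.
have [l [lP ->]] := lin_spanT x.
(* [N] is the sum of all the degrees [d b], hence above each of them. *)
have [N NP] : exists N, forall t, t \in l -> exists n, degD (d t.2.2) n = N.
  elim: l {lP} => [|t l [N NP]]; first by exists (deg0 k).
  exists (degD (d t.2.2) N) => u; rewrite inE => /orP [/eqP ->|/NP [n nE]].
    by exists N.
  by exists (degD n (d t.2.2)); rewrite degDA nE degDC.
exists N; apply: lin_span_sum => t tl; apply: lin_spanZ.
have [n <-] := NP t tl; rewrite (s_ss_expand n (lP t tl)).
apply: lin_span_sum => g /paths_ofP [rgg dg]; apply: lin_span_gen.
by rewrite !s_comp ?kg_d_comp ?dg -?(lP t tl).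
Qed.

(** * Action of diagonal elements and cycline pairs on long paths *)

Local Notation e m := (s m · ss m).

Lemma eK m : e m · s m = s m.
Proof. by rewrite mulA ss_s // eqxx sp. Qed.

Lemma ss_s_long b l n : d l = degD (d b) n ->
  (exists g, [/\ sc b = rg g, d g = n, l = b ** g & ss b · s l = s g]) \/
  ss b · s l = 0.
Proof.
move=> /deg_factor [b' [g [h db dg <-]]].
have [eb|nb] := eqVneq b b'; [left; subst b' | right].
  by exists g; split=> //; rewrite -sM // -mulA ss_s // eqxx h ps.
by rewrite -sM // -mulA ss_s // (negPf nb) mul0l.
Qed.

Lemma e_s_long m l n : d l = degD (d m) n -> e m · s l = s l \/ e m · s l = 0.
Proof.
move=> dl; rewrite mulA; have [[g [h _ -> ->]]|->] := ss_s_long dl.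
  by left; rewrite sM.
by right; rewrite mul0.
Qed.

(** The local units [p u] and [p v] stand in for an identity of the algebra: expanding them in
    degree [N] reduces to the tests. If [u] and [v] differ, orthogonality makes both elements
    zero. *)
Lemma eq_by_test N z w u v : z · p u = z -> w · p v = w ->
  (forall l, d l = N -> z · s l = w · s l) -> z = w.
Proof.
move=> zu wv test; have zwp x : z · p x = w · p x.
  rewrite (p_expand x N) !nualg_sumr // !big_seq; apply: eq_bigr => l.
  by move=> /paths_ofP [_ dl]; rewrite -!mulA test.
have [uv|uv] := eqVneq u v; first by rewrite -zu -wv -uv zwp.
have -> : z = 0 by rewrite -zu zwp -wv mulA pp0 ?mul0 //; apply/eqP; rewrite eq_sym.
by rewrite -wv -zwp -zu mulA pp0 ?mul0 //; apply/eqP.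
Qed.

Lemma s_ss_p a b : s a · ss b · p (rg b) = s a · ss b.
Proof. by rewrite mulA ssp. Qed.

Local Notation cycline := (cycline_pair L mul s ss).

(** If [l = b ** g], the new path is [a ** g], and the cycline condition at [g] equates the two
    idempotents. *)
Lemma cycline_act a b l n : cycline a b -> d l = degD (d b) n ->
  s a · ss b · s l = 0 \/
  exists l', [/\ s a · ss b · s l = s l', d l' = degD (d a) n & e l' = e l].
Proof.
move=> [ab cyc] dl; rewrite mulA; have [[g [h dg -> ->]]|->] := ss_s_long dl.
  right; exists (a ** g); rewrite sM ?ab // kg_d_comp ?ab // dg; split=> //.
  by apply: cyc; rewrite ab.
by left; rewrite mul0.
Qed.

(** Test on long [s l]. There [e m] either fixes or kills [s l], and it does the same to the image
    [s l'], since [s l' = e l · s l']. *)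
Lemma cycline_comm_diag a b m : cycline a b ->
  s a · ss b · e m = e m · (s a · ss b).
Proof.
move=> cyc; apply: (@eq_by_test (degD (d b) (d m)) _ _ (rg m) (rg b)).
- by rewrite mulA s_ss_p.
- by rewrite mulA s_ss_p.
move=> l dl; rewrite mulA (mulA (e m)).
have em : e m · s l = s l \/ e m · s l = 0.
  by apply: (@e_s_long _ _ (d b)); rewrite degDC.
have [x0|[l' [xl dl' el']]] := cycline_act cyc dl.
  by rewrite x0 mul0; case: em => ->; rewrite ?x0 ?mul0.
rewrite xl -(eK l') el' -(mulA (e m)) -(mulA (e m)).
by case: em => ->; rewrite ?xl ?mul0l ?mul0 // -el' eK.
Qed.

(** The properties of [x = s_a s_b^*], for [(a, b)] cycline with [d a = m],
    [d b = n] and [r b = u]: [x] acts on paths [l] of large degree without moving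
    the cylinder of [l], so it behaves like an isotropy element of degree [m - n]
    and [l'] depends on [l] and [m - n] only. *)
Definition isotropic (x : A) (u : kg_V L) (m n : deg k) : Prop :=
  [/\ x · p u = x, forall l, x · e l = e l · x &
    forall l q, d l = degD n q -> x · s l = 0 \/
      exists l', [/\ x · s l = s l', d l' = degD m q & e l' = e l]].

Lemma cycline_isotropic a b : cycline a b ->
  isotropic (s a · ss b) (rg b) (d a) (d b).
Proof.
move=> cyc; split; first exact: s_ss_p.
  by move=> l; apply: cycline_comm_diag.
by move=> l q; apply: cycline_act.
Qed.

(** If the paths differ, (KP3) forces both generators to vanish, so the conclusion is about [s l]
    and not about [l]. *)
Lemma s_eq_of_e l l' : d l = d l' -> e l = e l' -> s l = s l'.
Proof.
move=> dl el; have [-> //|ne] := eqVneq l l'.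
have -> : s l = 0 by rewrite -eK el mulA ss_s // eq_sym (negPf ne) mul0.
by rewrite -eK -el mulA ss_s // (negPf ne) mul0.
Qed.

(** On a long [s l], both products give zero or generators of paths with the same degree and the
    same idempotent as [l]; such generators are equal. *)
Lemma isotropic_comm x u m n y v m' n' :
  isotropic x u m n -> isotropic y v m' n' -> x · y = y · x.
Proof.
move=> [xp xe xs] [yp ye ys].
have kill z l : z · s l = 0 -> z · e l = 0 by rewrite -mulA => ->; rewrite mul0l.
(* Since [w · s l = e l · (w · s l)], whatever kills [e l] also kills [w · s l]. *)
have kill2 z w l : w · e l = e l · w -> z · s l = 0 -> z · (w · s l) = 0.
  by move=> we /kill z0; rewrite -eK -(mulA w) we -mulA -mulA z0 !mul0l.
pose q := degD m m'.
apply: (@eq_by_test (degD (degD n n') q) _ _ v u); rewrite ?mulA ?yp ?xp //.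
move=> l dl; rewrite !mulA.
have dl' : d l = degD n (degD n' q) by rewrite degDA.
have dl'' : d l = degD n' (degD n q) by rewrite dl (degDC n) degDA.
have [x0|[l1 [xl dl1 el1]]] := xs l _ dl'.
  by rewrite x0 mul0 kill2.
have [y0|[l2 [yl dl2 el2]]] := ys l _ dl''.
  by rewrite y0 mul0 kill2.
rewrite xl yl.
have dl1' : d l1 = degD n' (degD m q) by rewrite dl1 !degDA (degDC m).
have dl2' : d l2 = degD n (degD m' q) by rewrite dl2 !degDA (degDC m').
have [y0|[l3 [-> dl3 el3]]] := ys l1 _ dl1'.
  have yl0 : y · s l = 0 by rewrite -eK -el1 -mulA kill // mul0l.
  by rewrite y0 -yl yl0 mul0.
have [x0|[l4 [-> dl4 el4]]] := xs l2 _ dl2'.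
  have xl0 : x · s l = 0 by rewrite -eK -el2 -mulA kill // mul0l.
  have sl1 : s l1 = 0 by rewrite -xl.
  by rewrite x0 -eK el3 sl1 !mul0l.
apply: s_eq_of_e; last by rewrite el4 el2 el3 el1.
by rewrite dl3 dl4 !degDA (degDC m).
Qed.

(** * Reading coefficients off the path representation *)

Lemma exists_path_rep : exists f : A -> ((deg k -> P) * {ffun 'I_k -> int} -> R^o) ->
    ((deg k -> P) * {ffun 'I_k -> int} -> R^o),
  [/\ is_alg_hom mul (fun T U => T \o U) f, forall a, f a 0 = 0,
      forall l, f (s l) = op_s l & forall l, f (ss l) = op_ss l].
Proof.
pose M := ((deg k -> P) * {ffun 'I_k -> int} -> R^o).
pose lin (T : M -> M) := forall (c : R) F G, T (c *: F + G) = c *: T F + T G.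
have lin0 : lin 0 by move=> c F G; exact: esym (etrans (addr0 _) (scaler0 _ c)).
have addE (T U : M -> M) F : (T + U) F = T F + U F by [].
have scaleE c (T : M -> M) F : (c *: T) F = c *: T F by [].
have linD T U : lin T -> lin U -> lin (T + U).
  by move=> lT lU c F G; rewrite !addE lT lU scalerDr addrACA.
(* Scalar multiples of linear operators are linear because [R] is commutative. *)
have linZ (a : R) T : lin T -> lin (a *: T).
  by move=> lT c F G; rewrite !scaleE lT scalerDr !scalerA mulrC.
have lin_at0 T : lin T -> T 0 = 0.
  by move=> /(_ (-1) 0 0); rewrite scaler0 addr0 scaleN1r addNr.
have [] := @KP_hom_sub _ L R A mul p s ss univ _ (Submodule lin0 linD linZ)
  (fun T U => T \o U) (@op_p k L R) (@op_s k L R) (@op_ss k L R).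
- by move=> T U lT lU c F G; rewrite /= lU lT.
- move=> T U V lT lU lV; split=> //.
  apply/funext => F; rewrite /= !addE /=.
  by have := lT 1 (U F) (V F); rewrite !scale1r.
- move=> c T U lT lU; split=> //; apply/funext => F; rewrite /= !scaleE /=.
  by have := lT c (U F) 0; rewrite !addr0 lin_at0 // addr0.
- by move=> v c F G; apply: pullback_lin.
- by move=> l c F G; apply: pullback_lin.
- by move=> l c F G; apply: pullback_lin.
- exact: path_family.
move=> f [fh fl _ fs fss]; exists f; split=> // a.
exact: lin_at0 (fl a).
Qed.

Lemma coeff_icat x N (l : seq (R * (P * P))) a b y :
  (forall m, x · e m = e m · x) ->
  (forall t, t \in l -> sc t.2.1 = sc t.2.2 /\ d t.2.2 = N) ->
  x = \sum_(t <- l) t.1 *: (s t.2.1 · ss t.2.2) ->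
  sc a = sc b -> d b = N -> \sum_(t <- l | t.2 == (a, b)) t.1 <> 0 ->
  ipath y -> irange y = sc a -> icat a y = icat b y.
Proof.
move=> xe lP xE ab db c0 yP ya.
have yb : irange y = sc b by rewrite -ab.
have [f [[fD [fZ fM]] f0 fs fss]] := exists_path_rep.
pose z := (icat b y, 0 : {ffun 'I_k -> int}).
pose w := (icat a y, degZ (d a) - degZ N).
pose F : (deg k -> P) * {ffun 'I_k -> int} -> R^o :=
  fun u => if `[< u = z >] then 1 else 0.
have wP : ipath w.1 by apply: ipath_icat.
have zP : ipath z.1 by apply: ipath_icat.
(* The term of [(a, b)] carries [w] to [(y, - degZ N)] and then to [z], where the point mass [F] is
   1. *)
have fxE : f x F w = \sum_(t <- l | t.2 == (a, b)) t.1.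
  have f00 : f 0 = 0 by apply: (addrI (f 0)); rewrite -fD !addr0.
  rewrite xE (big_morph f fD f00) !fct_sumE [RHS]big_mkcond /=.
  rewrite !big_seq; apply: eq_bigr => -[c [a' b']] /lP /= [ab' db'].
  rewrite fZ fM fs fss -[LHS]/(c * op_s a' (op_ss b' F) w) /op_s /op_ss /pullback /F /w /z /=.
  have [[-> ->]|ne] := eqVneq (a', b') (a, b).
    rewrite asboolT ?icat_deg // tail_icat // asboolT // asboolT ?mulr1 //.
    by rewrite db addrAC subrK subrr.
  case: asboolP => [[_ wa]|_]; last by rewrite mulr0.
  case: asboolP => [[tP ta]|_]; last by rewrite mulr0.
  case: asboolP => [[h1 h2]|_]; last by rewrite mulr0.
  (* For another term to reach [z], the second coordinates force [d a' = d a]; then [a'] and [b']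
     are segments of [icat a y] and [icat b y] of the degrees of [a] and [b], so they equal [a] and
     [b]. *)
  move: h2; rewrite db' addrAC subrK => /subr0_eq /degZ_inj da.
  have a'E : a' = a by rewrite -wa -da icat_deg.
  have b'E : b' = b by rewrite -(icat_deg tP ta) db' -db h1 icat_deg.
  by rewrite a'E b'E eqxx in ne.
have [//|ne] := pselect (icat a y = icat b y).
have [m wm] : exists m, icat a y m <> icat b y m.
  apply: contrapT => h; apply: ne; apply/funext => m.
  by apply: contrapT => h'; apply: h; exists m.
(* The idempotent [e mu] is the indicator of the paths starting with [mu]: it kills the point mass
   at [z] but preserves values at [w]. Commuting with [x] therefore makes the coefficient zero. *)
pose mu := icat a y m.
have dmu : d mu = m by rewrite wP.1.
have opE G u : op_s mu (op_ss mu G) u =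
    if `[< ipath u.1 /\ u.1 m = mu >] then G u else 0 :> R^o.
  rewrite /op_s /op_ss pullback_comp /pullback /= dmu.
  case: asboolP => [[[uP um] _]|nu1]; last first.
    case: asboolP => // -[uP um]; case: nu1; split=> //.
    by split; [apply: ipath_tail | rewrite irange_tail // um].
  by rewrite asboolT // -{1}um icat_tail // subrK; case: u {uP um}.
have eF : f (e mu) F = 0.
  apply/funext => u; rewrite fM fs fss /= opE; case: asboolP => // -[uP um].
  rewrite /F asboolF // => uz; apply: wm; rewrite -/mu -um uz //.
have E1 : f (x · e mu) F w = 0 by rewrite fM /= eF f0.
have E2 : f (e mu · x) F w = f x F w by rewrite 2!fM fs fss /= opE asboolT.
by case: c0; rewrite -fxE -E2 -xe E1.
Qed.

(** Expand both idempotents in degree [d a + d b]. Extending [a ** h] to an infinite path shows that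
    it also starts with [b], so the two expansions run over the same paths. *)
Lemma icat_eq_diag a b : sc a = sc b ->
  (forall y, ipath y -> irange y = sc a -> icat a y = icat b y) -> e a = e b.
Proof.
have ext a' b' h : sc a' = sc b' ->
    (forall y, ipath y -> irange y = sc a' -> icat a' y = icat b' y) ->
    h \in paths_of (sc a') (d b') ->
    a' ** h \in [seq b' ** g | g <- paths_of (sc b') (d a')].
  move=> ab abE /paths_ofP [rh dh].
  have [y yP yh] := exists_ipath rf (sc h).
  have hyP : ipath (icat h y) by apply: ipath_icat.
  have rhy : irange (icat h y) = sc a' by rewrite irange_icat.
  have ahs : sc (a' ** h) = irange y by rewrite s_comp.
  apply/mapP; exists (icat h y (d a')).
    by apply/paths_ofP; rewrite r_ipath // rhy hyP.1.
  rewrite -(icat_seg _ hyP) -?ab // -abE // -icat_comp //.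
  by rewrite degDC -dh -kg_d_comp // icat_deg.
move=> ab abE; rewrite (s_ss_expand (d b)) // (s_ss_expand (d a)) //.
rewrite -(big_map (fun h => a ** h) xpredT (fun l => e l)).
rewrite -[RHS](big_map (fun h => b ** h) xpredT (fun l => e l)).
apply: perm_big; apply: uniq_perm.
- rewrite map_inj_in_uniq ?paths_of_uniq // => g h /paths_ofP [rgg _] /paths_ofP [rh _].
  by move=> E; case: (comp_inj (esym rgg) (esym rh) erefl E).
- rewrite map_inj_in_uniq ?paths_of_uniq // => g h /paths_ofP [rgg _] /paths_ofP [rh _].
  by move=> E; case: (comp_inj (esym rgg) (esym rh) erefl E).
move=> l; apply/idP/idP => /mapP [h hP ->]; first exact: ext.
by apply: ext => // y yP ya; rewrite abE ?ab.
Qed.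

Lemma icat_eq_cycline a b : sc a = sc b ->
  (forall y, ipath y -> irange y = sc a -> icat a y = icat b y) -> cycline a b.
Proof.
move=> ab abE; split=> // g rgg; apply: icat_eq_diag.
  by rewrite !s_comp -?ab.
move=> y yP; rewrite s_comp // => yg.
have gyP : ipath (icat g y) by apply: ipath_icat.
by rewrite !icat_comp -?ab // abE // irange_icat.
Qed.

(** * Comparison of the commutant with the cycline subalgebra *)

Lemma commutant_cycline x : commutant mul (diag_subalg L mul s ss) x ->
  cycline_subalg L mul s ss x.
Proof.
move=> xD; have xe m : x · e m = e m · x by apply: xD => S _; apply; exists m.
have [N [l [lP xE]]] := lin_span_degree x.
pose c q := \sum_(t <- l | t.2 == q) t.1.
(* Repeated pairs are merged, since only the total coefficient of a pair is visible in the
   representation. *)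
have -> : x = \sum_(q <- undup [seq t.2 | t <- l]) c q *: (s q.1 · ss q.2).
  rewrite xE; under [RHS]eq_bigr => q _.
    rewrite scaler_suml big_mkcond /=; over.
  rewrite exchange_big /= !big_seq; apply: eq_bigr => t tl.
  rewrite (bigD1_seq t.2) ?undup_uniq ?mem_undup ?map_f //= eqxx.
  by rewrite big1 ?addr0 // => q; rewrite eq_sym => /negPf ->.
have [M0 [MD [MZ _]]] := gen_subalgP mul
  (fun a => exists al be, cycline al be /\ a = s al · ss be).
rewrite big_seq; apply: big_ind => // -[a b]; rewrite mem_undup => /mapP [t tl].
move=> tE; have [ab db] := lP t tl; rewrite -tE /= in ab db.
have [-> |c0] := pselect (c (a, b) = 0); first by rewrite scale0r.
apply: MZ => S _; apply; exists a, b; split=> //.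
by apply: icat_eq_cycline => // y; apply: coeff_icat xE ab db c0.
Qed.

Lemma cycline_subalg_commutant x : cycline_subalg L mul s ss x ->
  commutant mul (diag_subalg L mul s ss) x.
Proof.
move=> Mx y; apply: gen_subalg_comm Mx => // _ _ [a [b [cyc ->]]] [m ->].
exact: cycline_comm_diag.
Qed.

Lemma cycline_subalg_comm : commutative_subalg mul (cycline_subalg L mul s ss).
Proof.
split; first exact: gen_subalgP.
apply: gen_subalg_comm => // _ _ [a [b [cx ->]]] [m [n [cy ->]]].
by apply: isotropic_comm; apply: cycline_isotropic.
Qed.

End KumjianPask.

Theorem theorem4p6 (k : nat) (L : kgraph k) (R : comPzRingType) (A : lmodType R)
    (mul : A -> A -> A) (p : kg_V L -> A) (s ss : kg_P L -> A) :
  row_finite_no_sources L ->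
  is_KP_algebra L mul p s ss ->
  (forall a, cycline_subalg L mul s ss a <->
             commutant mul (diag_subalg L mul s ss) a) /\
  maximal_commutative_subalg mul (cycline_subalg L mul s ss).
Proof.
move=> rf univ; split.
  move=> a; split; first exact: (cycline_subalg_commutant rf univ).
  exact: (commutant_cycline rf univ).
split; first exact: (cycline_subalg_comm rf univ).
(* A commutative [C] containing the cycline subalgebra contains the diagonal, because [(m, m)] is a
   cycline pair; hence [C] lies in the commutant. *)
move=> C [CP Ccomm] MC x Cx; apply: (commutant_cycline rf univ) => y Dy.
apply: Ccomm => //; apply: MC; apply: Dy; first exact: gen_subalgP.
by move=> _ [m ->] S _; apply; exists m, m.
Qed.
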